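(* For all integers $i, j \ge 2$, the Higman-Thompson group $G_{i,1}$ embeds into the Higman-Thompson group $G_{j,1}$; i.e., there exists an injective group homomorphism $G_{i,1} \to G_{j,1}$.
   Context: For an integer $k \ge 2$ let $A = A_k = \{a_0, a_1, \ldots, a_{k-1}\}$ be an alphabet with $k$ letters, and let $A^*$ be the set of all finite strings over $A$ (including the empty string $\varepsilon$). For $x, p \in A^*$, $p$ is a prefix of $x$ iff $x = pu$ for some $u \in A^*$. A prefix code is a set $P \subset A^*$ in which no element is a prefix of a different element; it is maximal if it is not a strict subset of any other prefix code of $A^*$. A right ideal of $A^*$ is a set $R \subseteq A^*$ with $R = R A^*$. Every finitely generated right ideal is generated by a unique finite prefix code. ''Function'' means partial function. A right ideal morphism of $A^*$ is a partial function $f: A^* \to A^*$ such that for all $x \in \mathrm{Dom}(f)$ and all $w \in A^*$: $xw \in \mathrm{Dom}(f)$ and $f(xw) = f(x)\,w$. Then $\mathrm{Dom}(f)$ and $\mathrm{Im}(f)$ are right ideals; the prefix codes generating them are denoted $\mathrm{domC}(f)$ and $\mathrm{imC}(f)$. Let $\mathcal{RI}_k^{\mathsf{fin}}$ be the set of all injective right ideal morphisms $f$ of $A_k^*$ such that $\mathrm{domC}(f)$ and $\mathrm{imC}(f)$ are finite maximal prefix codes. Every $f \in \mathcal{RI}_k^{\mathsf{fin}}$ is contained (as a set of pairs) in a unique $\subseteq$-maximum right ideal morphism in $\mathcal{RI}_k^{\mathsf{fin}}$, called the maximum extension of $f$. The Higman-Thompson group $G_{k,1}$ consists, as a set, of those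 $f \in \mathcal{RI}_k^{\mathsf{fin}}$ that are maximum extensions (i.e., equal to their own maximum extension); the multiplication is composition of partial functions followed by maximum extension. With this multiplication $G_{k,1}$ is a group. *)

(* Defs.v *)
From HB Require Import structures.
From mathcomp Require Import all_boot.
From mathcomp Require Import boolp classical_sets functions cardinality.

Set Implicit Arguments.
Unset Strict Implicit.
Unset Printing Implicit Defensive.

Local Open Scope classical_set_scope.

Section Definitions.
Variable k : nat.
Implicit Types (P Q R : set (seq 'I_k)) (x y w : seq 'I_k).

Definition prefix_code P :=
  forall x y, P x -> P y -> prefix x y -> x = y.

Definition maximal_prefix_code P :=
  prefix_code P /\ forall Q, prefix_code Q -> ~ (P `<` Q).

(* the set [P A^*] *)
Definition ideal_of P : set (seq 'I_k) :=
  [set x | exists p u, P p /\ x = p ++ u].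

Definition right_ideal R := R = ideal_of R.

(* The prefix code generating [R]. For a right ideal it exists and is unique
   (lemmas [ideal_code_spec] and [ideal_code_unique]). *)
Definition ideal_code R : set (seq 'I_k) :=
  xget set0 [set P | prefix_code P /\ R = ideal_of P].

(* Partial functions are [option]-valued functions. *)
Definition pfun := seq 'I_k -> option (seq 'I_k).

Implicit Types f g h : pfun.

Definition pfun_sub f g := forall x y, f x = Some y -> g x = Some y.

Definition pfun_comp f g : pfun := fun x => obind f (g x).

Definition pfun_injective f :=
  forall x x' y, f x = Some y -> f x' = Some y -> x = x'.

Definition pdom f : set (seq 'I_k) := [set x | exists y, f x = Some y].
Definition pim f : set (seq 'I_k) := [set y | exists x, f x = Some y].

Definition right_ideal_morphism f :=
  forall x y w, f x = Some y -> f (x ++ w) = Some (y ++ w).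

Definition domC f := ideal_code (pdom f).
Definition imC f := ideal_code (pim f).

Definition finite_maximal_prefix_code P :=
  finite_set P /\ maximal_prefix_code P.

Definition RIfin f :=
  [/\ right_ideal_morphism f, pfun_injective f,
      finite_maximal_prefix_code (domC f) &
      finite_maximal_prefix_code (imC f)].

Definition is_max_extension f g :=
  [/\ RIfin g, pfun_sub f g &
      forall h, RIfin h -> pfun_sub f h -> pfun_sub h g].

(* Exists and is unique for [f] in [RIfin] (lemmas [max_extensionP] and
   [is_max_extension_unique]). *)
Definition max_extension f : pfun :=
  xget (f : {classic pfun}) [set g | is_max_extension f g].

(* The carrier of the Higman-Thompson group [G_{k,1}]. *)
Record HigmanThompson := HT {
  ht_fun :> pfun;
  ht_RIfin : RIfin ht_fun;
  ht_max : max_extension ht_fun = ht_fun }.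

End Definitions.

Section Ideals.
Variable k : nat.
Implicit Types (P Q R : set (seq 'I_k)) (x y w : seq 'I_k).

Lemma ideal_ofP P x : ideal_of P x <-> exists2 p, P p & prefix p x.
Proof.
split=> [[p [u [Pp ->]]]|[p Pp /prefixP[u ->]]].
  by exists p => //; apply: prefix_prefix.
by exists p, u.
Qed.

Lemma right_idealP R : right_ideal R <-> forall x w, R x -> R (x ++ w).
Proof.
split=> [-> x w [p [u [Rp ->]]]|h]; first by exists p, (u ++ w); rewrite catA.
apply/seteqP; split=> [x Rx|x [p [u [Rp ->]]]]; last exact: h.
by exists x, [::]; rewrite cats0.
Qed.

Lemma prefix_le x y z :
  prefix x z -> prefix y z -> size x <= size y -> prefix x y.
Proof.
move=> /prefixP[u ->]; rewrite !prefixE => /eqP <-.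
rewrite size_take_min leq_min => /andP[xy _].
by rewrite take_takel // take_size_cat.
Qed.

Lemma prefix_comparable x y z :
  prefix x z -> prefix y z -> prefix x y \/ prefix y x.
Proof.
move=> xz yz; case: (leqP (size x) (size y)) => [|/ltnW] h; [left|right].
  exact: prefix_le xz yz h.
exact: prefix_le yz xz h.
Qed.

Lemma ideal_code_spec R : right_ideal R ->
  prefix_code (ideal_code R) /\ R = ideal_of (ideal_code R).
Proof.
move=> Ri; rewrite /ideal_code; set X := [set P | _].
apply: (@xgetPex _ set0 X).
exists [set p | R p /\ forall q, R q -> prefix q p -> q = p]; split.
  by move=> x y [Rx _] [_ ymin]; apply: ymin.
apply/seteqP; split=> [x Rx|x]; last first.
  by move=> [p [u [[Rp _] ->]]]; rewrite Ri; exists p, u.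
apply/ideal_ofP.
have [n] := ubnP (size x); elim: n x Rx => // n IH x Rx; rewrite ltnS => xn.
have [[q [Rq qx qNx]]|xmin] := pselect (exists q, [/\ R q, prefix q x & q <> x]).
  have qltx : size q < size x.
    rewrite ltn_neqAle size_prefix // andbT; apply/eqP => qe.
    by move: qx; rewrite prefixE qe take_size => /eqP/esym.
  have [p pmin pq] := IH q Rq (leq_trans qltx xn).
  by exists p => //; apply: prefix_trans pq qx.
exists x; last exact: prefix_refl.
split=> // q Rq qx; apply: contrapT => qNx; apply: xmin; by exists q.
Qed.

Lemma ideal_of_inj P Q : prefix_code P -> prefix_code Q ->
  ideal_of P = ideal_of Q -> P = Q.
Proof.
suff sub P' Q' : prefix_code P' -> ideal_of P' = ideal_of Q' -> P' `<=` Q'.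
  by move=> hP hQ e; apply/seteqP; split; apply: sub.
move=> hP e p Pp.
have /ideal_ofP[q Qq qp] : ideal_of Q' p.
  by rewrite -e; exists p, [::]; rewrite cats0.
have /ideal_ofP[p' Pp' p'q] : ideal_of P' q.
  by rewrite e; exists q, [::]; rewrite cats0.
have p'p := hP _ _ Pp' Pp (prefix_trans p'q qp); subst p'.
suff -> : p = q by [].
move: p'q qp => /prefixP[u ->] /size_prefix; rewrite size_cat -[leqRHS]addn0.
by rewrite leq_add2l leqn0 size_eq0 => /eqP->; rewrite cats0.
Qed.

Lemma ideal_code_unique P R :
  prefix_code P -> R = ideal_of P -> ideal_code R = P.
Proof.
move=> hP hR; apply: xget_unique => // Q [hQ hR'].
by apply: ideal_of_inj => //; rewrite -hR -hR'.
Qed.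

(* [big R] characterizes the right ideals generated by a finite maximal
   prefix code (lemma [bigP]), including when [k < 2]. *)
Definition dense R := forall x, exists w, R (x ++ w).
Definition cofin R := exists N, forall x, N <= size x -> R x.
Definition big R := dense R /\ cofin R.

Lemma big_sub R Q : R `<=` Q -> big R -> big Q.
Proof.
move=> RQ [dR [N cR]]; split=> [x|]; last by exists N => x /cR/RQ.
by have [w /RQ] := dR x; exists w.
Qed.

Lemma prefix_codeU1 P x : prefix_code P ->
  (forall p, P p -> ~ prefix p x /\ ~ prefix x p) -> prefix_code (x |` P).
Proof.
move=> hP hx a b [->|Pa] [->|Pb] //; last exact: hP.
- by move=> /(hx _ Pb).2.
- by move=> /(hx _ Pa).1.
Qed.

Lemma maximal_dense P : prefix_code P ->
  maximal_prefix_code P <-> dense (ideal_of P).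
Proof.
move=> hP; split=> [[_ Pmax] x|dP].
  have [[p Pp pxxp]|nP] :=
      pselect (exists2 p, P p & prefix p x \/ prefix x p).
    case: pxxp => [px|/prefixP[w e]].
      by exists [::]; rewrite cats0; apply/ideal_ofP; exists p.
    by exists w; exists p, [::]; rewrite cats0 -e.
  have Px : ~ P x.
    by move=> Px; apply: nP; exists x => //; left; apply: prefix_refl.
  case: (Pmax (x |` P)).
    by apply: prefix_codeU1 => // p Pp; split=> h; apply: nP; exists p; auto.
  by split=> [y ?|/(_ x (or_introl erefl))//]; right.
split=> // Q hQ [PQ nQP]; apply: nQP => q Qq.
have [w /ideal_ofP[p Pp pqw]] := dP q.
suff -> : q = p by [].
have [pq|qp] := prefix_comparable pqw (prefix_prefix q w).
  by apply/esym/hQ => //; apply: PQ.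
by apply: hQ => //; apply: PQ.
Qed.

Lemma finite_cofin P : prefix_code P -> dense (ideal_of P) ->
  finite_set P <-> cofin (ideal_of P).
Proof.
move=> hP dP; split=> [/finite_seqP[s Ps]|[N cP]].
  exists (\max_(p <- s) size p) => x xs.
  have [w /ideal_ofP[p Pp pxw]] := dP x.
  apply/ideal_ofP; exists p => //; apply: prefix_le pxw (prefix_prefix _ _) _.
  move: Pp; rewrite Ps /= => ps; apply: leq_trans xs.
  by rewrite (big_rem p) //= leq_maxl.
have finN : finite_set [set x : seq 'I_k | size x <= N].
  have := finite_image (fun t : {bseq N of 'I_k} => t : seq 'I_k)
    (@finite_finset _ [set: {bseq N of 'I_k}]).
  apply: sub_finite_set => x /= xN; by exists (Bseq xN).
apply: sub_finite_set finN => p Pp /=; rewrite leqNgt; apply/negP => Np.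
have /cP/ideal_ofP[q Pq qp] : N <= size (take N p).
  by rewrite size_takel // ltnW.
have := hP _ _ Pq Pp (prefix_trans qp (prefix_take _ _)) => qe.
move: qp => /size_prefix; rewrite qe size_takel; last exact: ltnW.
by rewrite leqNgt Np.
Qed.

Lemma bigP R : right_ideal R ->
  finite_maximal_prefix_code (ideal_code R) <-> big R.
Proof.
move=> /ideal_code_spec[hP {2}->].
split=> [[fP /(maximal_dense hP) dP]|[dP cP]].
  by split=> //; apply/finite_cofin.
by split; [apply/finite_cofin|apply/maximal_dense].
Qed.

End Ideals.

Section Morphisms.
Variable k : nat.
Implicit Types (f g h : pfun k) (x y w : seq 'I_k).

Lemma right_ideal_pdom f : right_ideal_morphism f -> right_ideal (pdom f).
Proof.
by move=> hf; apply/right_idealP => x w [y fx]; exists (y ++ w); apply: hf.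
Qed.

Lemma right_ideal_pim f : right_ideal_morphism f -> right_ideal (pim f).
Proof.
by move=> hf; apply/right_idealP => y w [x fx]; exists (x ++ w); apply: hf.
Qed.

Lemma RIfinP f : RIfin f <->
  [/\ right_ideal_morphism f, pfun_injective f, big (pdom f) & big (pim f)].
Proof.
split=> -[hf fi df imf]; split=> //.
- exact/bigP/df/right_ideal_pdom.
- exact/bigP/imf/right_ideal_pim.
- exact/bigP/df/right_ideal_pdom.
- exact/bigP/imf/right_ideal_pim.
Qed.

Lemma pfun_sub_anti f g : pfun_sub f g -> pfun_sub g f -> f = g.
Proof.
move=> fg gf; apply/funext => x; case fx: (f x) => [y|]; first exact/esym/fg.
by case gx: (g x) => [y|//]; rewrite (gf _ _ gx) in fx.
Qed.

Lemma pfun_sub_trans f g h : pfun_sub f g -> pfun_sub g h -> pfun_sub f h.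
Proof. by move=> fg gh x y /fg/gh. Qed.

Lemma catsI : left_injective (@cat 'I_k).
Proof.
move=> u x y e; have /eqP := e; rewrite eqseq_cat; first by case/andP=> /eqP.
by move/(congr1 size): e; rewrite !size_cat => /addIn.
Qed.

Definition extends_at f x y := forall w z, f (x ++ w) = Some z -> z = y ++ w.

Lemma extends_at_unique f x y y' : dense (pdom f) ->
  extends_at f x y -> extends_at f x y' -> y = y'.
Proof.
move=> df e e'; have [w [z fz]] := df x; apply: (@catsI w).
by rewrite /= -(e _ _ fz) -(e' _ _ fz).
Qed.

Definition graph_max f : pfun k := fun x =>
  xget None [set o | exists2 y, o = Some y & extends_at f x y].

Lemma graph_maxP f x y : dense (pdom f) ->
  graph_max f x = Some y <-> extends_at f x y.
Proof.
move=> df; rewrite /graph_max; split=> [|e].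
  by case: xgetP => [o -> [y' -> ?] [<-]|].
apply: xget_unique; first by exists y.
by move=> _ [y' -> e']; rewrite (extends_at_unique df e e').
Qed.

Lemma graph_max_sub f : RIfin f -> pfun_sub f (graph_max f).
Proof.
move=> /RIfinP[hf _ [df _] _] x y fx; apply/graph_maxP => // w z.
by rewrite (hf _ _ _ fx) => -[].
Qed.

Lemma graph_max_RIfin f : RIfin f -> RIfin (graph_max f).
Proof.
move=> Rf; have := graph_max_sub Rf.
move/RIfinP: Rf => [hf fi [df cf] imf] sub; apply/RIfinP; split.
- move=> x y w /graph_maxP-/(_ df) e; apply/graph_maxP => // v z.
  by rewrite -!catA => /e.
- move=> x x' y /graph_maxP-/(_ df) e /graph_maxP-/(_ df) e'.
  have [w [z fz]] := df x; have [v [z' fz']] := df (x' ++ w).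
  have fxv := hf _ _ v fz; apply: (@catsI (w ++ v) x x').
  rewrite -catA in fz'; rewrite -catA in fxv;
  apply: (fi _ _ _ fxv).
  by rewrite (e _ _ fxv) fz' (e' _ _ fz').
- by apply: big_sub (conj df cf) => x [y /sub]; exists y.
- by apply: big_sub imf => y [x /sub]; exists x.
Qed.

Lemma is_max_graph_max f : RIfin f -> is_max_extension f (graph_max f).
Proof.
move=> Rf; split; [exact: graph_max_RIfin|exact: graph_max_sub|].
move=> h /RIfinP[hh _ _ _] fh x y hx; apply/graph_maxP.
  by case/RIfinP: Rf => _ _ [].
by move=> w z /fh; rewrite (hh _ _ _ hx) => -[].
Qed.

Lemma is_max_extension_unique f g h :
  is_max_extension f g -> is_max_extension f h -> g = h.
Proof.
by move=> [Rg fg mg] [Rh fh mh]; apply: pfun_sub_anti; [apply: mh|apply: mg].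
Qed.

Lemma max_extensionP f : RIfin f -> is_max_extension f (max_extension f).
Proof.
move=> Rf; rewrite /max_extension.
apply: (@xgetPex {classic pfun k} f [set g | is_max_extension f g]).
by exists (graph_max f); apply: is_max_graph_max.
Qed.

Lemma max_extension_RIfin f : RIfin f -> RIfin (max_extension f).
Proof. by case/max_extensionP. Qed.

Lemma max_extension_sub f : RIfin f -> pfun_sub f (max_extension f).
Proof. by case/max_extensionP. Qed.

Lemma max_extension_eq f g : RIfin f -> RIfin g -> pfun_sub f g ->
  max_extension f = max_extension g.
Proof.
move=> Rf Rg fg.
have [Rf' ff' mf] := max_extensionP Rf; have [Rg' gg' mg] := max_extensionP Rg.
apply: pfun_sub_anti; last by apply: mf => //; apply: pfun_sub_trans gg'.
by apply: mg => //; apply: mf.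
Qed.

Lemma max_extension_id f : RIfin f ->
  max_extension (max_extension f) = max_extension f.
Proof.
move=> Rf; apply/esym/max_extension_eq => //; first exact: max_extension_RIfin.
exact: max_extension_sub.
Qed.

Definition pinv f : pfun k := fun y =>
  xget None [set o | exists2 x, o = Some x & f x = Some y].

Lemma pinvP f x y : pfun_injective f -> pinv f y = Some x <-> f x = Some y.
Proof.
move=> fi; rewrite /pinv; split=> [|e].
  by case: xgetP => [o -> [x' -> ?] [<-]|].
apply: xget_unique; first by exists x.
by move=> _ [x' -> e']; rewrite (fi _ _ _ e e').
Qed.

Lemma pinv_RIfin f : RIfin f -> RIfin (pinv f).
Proof.
move=> /RIfinP[hf fi df imf]; apply/RIfinP; split.
- by move=> y x w /pinvP-/(_ fi)/hf fx; apply/pinvP.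
- by move=> y y' x /pinvP-/(_ fi) e /pinvP-/(_ fi); rewrite e => -[].
- by apply: big_sub imf => y [x fx]; exists x; apply/pinvP.
- by apply: big_sub df => x [y fx]; exists y; apply/pinvP.
Qed.

Lemma pfun_compP f g x z :
  pfun_comp f g x = Some z <-> exists2 y, g x = Some y & f y = Some z.
Proof.
rewrite /pfun_comp; case: (g x) => [y|] /=; last by split=> [|[]].
by split=> [|[_ [<-]]] //; exists y.
Qed.

Lemma big_comp_dom f g : RIfin f -> RIfin g -> big (pdom (pfun_comp f g)).
Proof.
move=> /RIfinP[hf fi [df [N cf]] _] /RIfinP[hg gi [dg [M cg]] _]; split.
  move=> x; have [w [y gy]] := dg x; have [v [z fz]] := df y.
  exists (w ++ v), z; rewrite catA; apply/pfun_compP.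
  by exists (y ++ v) => //; apply: hg.
exists (M + N) => x xs.
have /cg[y gy] : M <= size (take M x).
  by rewrite size_takel // (leq_trans _ xs) ?leq_addr.
have /cf[z fz] : N <= size (y ++ drop M x).
  rewrite size_cat size_drop (leq_trans _ (leq_addl _ _)) //.
  by rewrite leq_subRL // (leq_trans _ xs) ?leq_addr.
exists z; apply/pfun_compP; exists (y ++ drop M x) => //.
by rewrite -(hg _ _ _ gy) cat_take_drop.
Qed.

Lemma pfun_comp_RIfin f g : RIfin f -> RIfin g -> RIfin (pfun_comp f g).
Proof.
move=> Rf Rg; have dfg := big_comp_dom Rf Rg.
have := big_comp_dom (pinv_RIfin Rg) (pinv_RIfin Rf).
move: Rf Rg => /RIfinP[hf fi _ _] /RIfinP[hg gi _ _] ifg.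
apply/RIfinP; split=> //.
- move=> x z w /pfun_compP[y gx fy]; apply/pfun_compP.
  by exists (y ++ w); [apply: hg|apply: hf].
- move=> x x' z /pfun_compP[y gx fy] /pfun_compP[y' gx' fy'].
  by rewrite -(fi _ _ _ fy fy') in gx'; apply: gi gx gx'.
- apply: big_sub ifg => z [x /pfun_compP[y /pinvP-/(_ fi) fy /pinvP-/(_ gi) gx]].
  by exists x; apply/pfun_compP; exists y.
Qed.

Definition pid : pfun k := @Some _.

Lemma pid_RIfin : RIfin pid.
Proof.
have bT : big [set: seq 'I_k].
  by split=> [x|]; [exists [::]|exists 0].
apply/RIfinP; split.
- by move=> x _ w [<-].
- by move=> x x' y [->] [->].
- by apply: big_sub bT => x _; exists x.
- by apply: big_sub bT => x _; exists x.
Qed.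

Lemma max_extension_pid : max_extension pid = pid.
Proof.
have sub := max_extension_sub pid_RIfin.
apply: pfun_sub_anti => // x y; by rewrite (sub x x erefl).
Qed.

End Morphisms.

Section Group.
Variable k : nat.
Implicit Types f g h : HigmanThompson k.

HB.instance Definition _ := gen_eqMixin (HigmanThompson k).
HB.instance Definition _ := gen_choiceMixin (HigmanThompson k).

Definition ht_of (f : pfun k) (Rf : RIfin f) : HigmanThompson k :=
  HT (max_extension_RIfin Rf) (max_extension_id Rf).

Definition ht_mul f g : HigmanThompson k :=
  ht_of (pfun_comp_RIfin (ht_RIfin f) (ht_RIfin g)).

Definition ht_one : HigmanThompson k := ht_of (@pid_RIfin k).

Definition ht_inv f : HigmanThompson k := ht_of (pinv_RIfin (ht_RIfin f)).

Lemma ht_ext f g : ht_fun f = ht_fun g -> f = g.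
Proof.
case: f g => [f Rf mf] [g Rg mg] /= e; subst g.
by rewrite (Prop_irrelevance Rf Rg) (Prop_irrelevance mf mg).
Qed.

Lemma ht_oneE : ht_fun ht_one = @pid k.
Proof. exact: max_extension_pid. Qed.

Lemma ht_mulA : associative ht_mul.
Proof.
move=> f g h; apply: ht_ext => /=.
have [[Rf Rg] Rh] := (ht_RIfin f, ht_RIfin g, ht_RIfin h).
have Rfg := pfun_comp_RIfin Rf Rg; have Rgh := pfun_comp_RIfin Rg Rh.
have Rfgh := pfun_comp_RIfin Rfg Rh.
transitivity (max_extension (pfun_comp (pfun_comp f g) h)).
  apply/esym/max_extension_eq => //.
    by apply: pfun_comp_RIfin => //; apply: max_extension_RIfin.
  move=> x t /pfun_compP[y hx /pfun_compP[z gy fz]]; apply/pfun_compP.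
  exists z => //; apply: max_extension_sub => //.
  by apply/pfun_compP; exists y.
apply: max_extension_eq => //.
  by apply: pfun_comp_RIfin => //; apply: max_extension_RIfin.
move=> x t /pfun_compP[y hx fgy]; apply/pfun_compP; exists y => //.
exact: max_extension_sub.
Qed.

Lemma ht_mul1g : left_id ht_one ht_mul.
Proof.
move=> f; apply: ht_ext; rewrite /= max_extension_pid -[RHS]ht_max.
congr max_extension; apply/funext => x.
by rewrite /pfun_comp; case: (ht_fun f x).
Qed.

Lemma ht_mulg1 : right_id ht_one ht_mul.
Proof.
by move=> f; apply: ht_ext; rewrite /= max_extension_pid -[RHS]ht_max.
Qed.

Lemma ht_mulVg : left_inverse ht_one ht_inv ht_mul.
Proof.
move=> f; apply: ht_ext => /=; have Rf := ht_RIfin f.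
have Rfi := pinv_RIfin Rf.
have Rc := pfun_comp_RIfin Rfi Rf.
have /RIfinP[_ fi _ _] := Rf.
transitivity (max_extension (pfun_comp (pinv f) f)).
  apply/esym/max_extension_eq => //.
    by apply: pfun_comp_RIfin => //; apply: max_extension_RIfin.
  move=> x t /pfun_compP[y hx fgy]; apply/pfun_compP; exists y => //.
  exact: max_extension_sub.
apply: max_extension_eq => //; first exact: pid_RIfin.
move=> x t /pfun_compP[y fx /pinvP-/(_ fi) ft].
by rewrite /pid (fi _ _ _ fx ft).
Qed.

Lemma ht_mulgV : right_inverse ht_one ht_inv ht_mul.
Proof.
move=> f; apply: ht_ext => /=; have Rf := ht_RIfin f.
have Rfi := pinv_RIfin Rf.
have Rc := pfun_comp_RIfin Rf Rfi.
have /RIfinP[_ fi _ _] := Rf.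
transitivity (max_extension (pfun_comp f (pinv f))).
  apply/esym/max_extension_eq => //.
    by apply: pfun_comp_RIfin => //; apply: max_extension_RIfin.
  move=> y t /pfun_compP[x fx fxt]; apply/pfun_compP; exists x => //.
  exact: max_extension_sub.
apply: max_extension_eq => //; first exact: pid_RIfin.
by move=> y t /pfun_compP[x /pinvP-/(_ fi) fx]; rewrite fx.
Qed.

HB.instance Definition _ := isGroup.Build (HigmanThompson k)
  ht_mulA ht_mul1g ht_mulg1 ht_mulVg ht_mulgV.

End Group.

(* Main.v *)
(* Write A for the alphabet with j letters and X for the clopen set of words of
   A^omega whose first letter is not a_0. It is a disjoint union of j - 1 cones,
   and subdividing a cone adds j - 1 to the number of cones; so i - 1
   subdivisions give i (j - 1) cones, and X splits into i copies of itself,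
   given by piecewise prefix replacements s_t : X -> X for t < i. For a word
   p = t_1 ... t_n over the alphabet with i letters put
   s_p = s_t_1 o ... o s_t_n. An element f of G_{i,1} then acts on s_p(X), for p
   in the domain of f, as s_{f(p)} o s_p^{-1}, and as the identity on the cone
   at a_0. *)
Require Import Defs.
From HB Require Import structures.
From mathcomp Require Import all_boot.
From mathcomp Require Import boolp classical_sets.

Set Implicit Arguments.
Unset Strict Implicit.
Unset Printing Implicit Defensive.

Section Splitting.
Variables i j : nat.
Local Notation I := 'I_i.+2.
Local Notation A := 'I_j.+2.
Local Notation a0 := (ord0 : A).
Implicit Types (t : I) (p q r : seq I) (u v w : seq A).

(** * Splitting X into [i.+2] copies of itself *)

Definition a1 : A := Ordinal (isT : 1 < j.+2).

(** The default [a0] excludes the empty word, so every word in [inX] has a first letter for [split1]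
    to replace. *)
Definition inX u := head a0 u != a0.

(* The cones [split_code t m], for [m != a0], partition [X]: they are the cones
   [a1^t m] with [m != a1], together with [a1^(i.+2)]. The code of [(t, a1)]
   is [a1^t a0] if [t > 0]; as [a0] is not in [X], it is [a1^(i.+2)] if
   [t = 0]. *)
Definition split_code t (m : A) : seq A :=
  if m != a1 then rcons (nseq t a1) m
  else if t == ord0 then nseq i.+2 a1 else rcons (nseq t a1) a0.

Definition split1 t u := if u is m :: w then split_code t m ++ w else [::].

(** Decodes by the length [n] of the leading run of [a1]. In the first branch, dropping [i.+1]
    letters instead of [i.+2] keeps one [a1] as the restored first letter. *)
Definition unsplit1 u : I * seq A :=
  let n := find (predC1 a1) u in
  if i.+2 <= n then (ord0, drop i.+1 u)
  else let m := nth a0 u n in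
    (inord n, (if (0 < n) && (m == a0) then a1 else m) :: drop n.+1 u).

Lemma inX_cat u w : inX u -> inX (u ++ w).
Proof. by case: u. Qed.

Lemma split1_cat t u w : inX u -> split1 t (u ++ w) = split1 t u ++ w.
Proof. by case: u => [|m u] //= _; rewrite catA. Qed.

Lemma inX_split1 t u : inX u -> inX (split1 t u).
Proof.
case: u => [|m u] // mX; rewrite /split1 /split_code.
case: eqP => _ /=; last by case: t => -[|n] nlt.
by case: t => -[|n] nlt.
Qed.

Lemma find_rcons_nseq n (m : A) w : m != a1 ->
  find (predC1 a1) (rcons (nseq n a1) m ++ w) = n.
Proof. by move=> mN; elim: n => [|n /= ->]; rewrite /= ?mN. Qed.

Lemma leq_find_nseq n w : n <= find (predC1 a1) (nseq n a1 ++ w).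
Proof. by elim: n. Qed.

Lemma nth_rcons_nseq n (m : A) w : nth a0 (rcons (nseq n a1) m ++ w) n = m.
Proof. by elim: n. Qed.

Lemma drop_rcons_nseq n (m : A) w : drop n.+1 (rcons (nseq n a1) m ++ w) = w.
Proof. by elim: n => [|n IH] //=; rewrite drop0. Qed.

Lemma split1K t u : inX u -> unsplit1 (split1 t u) = (t, u).
Proof.
case: u => [|m u] //; rewrite /inX /= => mX; rewrite /split_code.
case: (eqVneq m a1) => [->|mN] /=; last first.
  rewrite /unsplit1 find_rcons_nseq // leqNgt ltn_ord /= nth_rcons_nseq.
  by rewrite (negPf mX) andbF drop_rcons_nseq inord_val.
case: (eqVneq t ord0) => [->|tN].
  rewrite /unsplit1 /= !ltnS leq_find_nseq.
  by congr (_, _); elim: (i).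
rewrite /unsplit1 find_rcons_nseq // leqNgt ltn_ord /= nth_rcons_nseq eqxx.
by rewrite lt0n tN /= drop_rcons_nseq inord_val.
Qed.

Lemma split1_inj t t' u u' : inX u -> inX u' ->
  split1 t u = split1 t' u' -> t = t' /\ u = u'.
Proof.
by move=> uX uX' /(congr1 unsplit1); rewrite !split1K // => -[].
Qed.

Lemma take_find_nseq u :
  take (find (predC1 a1) u) u = nseq (find (predC1 a1) u) a1.
Proof. by elim: u => [|m u IH] //=; case: eqP => //= ->; rewrite IH. Qed.

(** Within [i.+2] letters the run of [a1] either completes the longest code or meets another letter.
    A code of length at most [i.+2] replaces one letter, so at most [i.+1] letters are lost. *)
Lemma split1_surj u : inX u -> i.+2 <= size u ->
  exists t v, [/\ inX v, u = split1 t v & size u <= size v + i.+1].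
Proof.
move=> uX uS; set n := find (predC1 a1) u.
have un := take_find_nseq u; rewrite -/n in un.
have [ni|ni] := leqP i.+2 n.
  exists ord0, (a1 :: drop i.+2 u); split=> //; last first.
    by rewrite /= size_drop addSnnS addnC subnKC.
  by rewrite -[LHS](cat_take_drop i.+2) -(take_takel u ni) un take_nseq.
have nS : n < size u by apply: leq_trans uS.
have mN : nth a0 u n != a1.
  by apply: (@nth_find _ a0 (predC1 a1)); rewrite has_find.
have ue : u = rcons (nseq n a1) (nth a0 u n) ++ drop n.+1 u.
  by rewrite -un -take_nth // cat_take_drop.
have tv : nat_of_ord (inord n : I) = n by rewrite inordK.
have szu m : size u <= size (m :: drop n.+1 u) + i.+1.
  by rewrite /= size_drop subnSK // addnC -{1}(subnKC (ltnW nS)) leq_add2r.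
have [m0|m0] := eqVneq (nth a0 u n) a0; last first.
  by exists (inord n), (nth a0 u n :: drop n.+1 u); split=> //;
     rewrite /= /split_code mN tv.
exists (inord n), (a1 :: drop n.+1 u); split=> //.
(* An [a0] ending an empty run would be the first letter of [u]. *)
have n0 : (inord n : I) != ord0.
  rewrite -val_eqE /= tv; apply/eqP => n0.
  by move: uX; rewrite /inX -nth0 -n0 m0 eqxx.
by rewrite /= /split_code eqxx /= (negPf n0) tv {1}ue m0.
Qed.

(** * Splittings indexed by words *)

Definition split p u := foldr split1 u p.

Lemma inX_split p u : inX u -> inX (split p u).
Proof. by move=> uX; elim: p => //= t p; apply: inX_split1. Qed.

Lemma split_catl p r u : split (p ++ r) u = split p (split r u).
Proof. exact: foldr_cat. Qed.

Lemma split_catr p u w : inX u -> split p (u ++ w) = split p u ++ w.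
Proof.
by move=> uX; elim: p => //= t p ->; rewrite split1_cat //; apply: inX_split.
Qed.

(** The copies of X are disjoint, so the two index words agree letter by letter until one of them
    ends. *)
Lemma split_comparable p p' u u' : inX u -> inX u' ->
  split p u = split p' u' ->
  (exists2 r, p' = p ++ r & u = split r u') \/
  (exists2 r, p = p' ++ r & u' = split r u).
Proof.
move=> uX uX'; elim: p p' => [|t p IH] [|t' p'] e.
- by left; exists [::].
- by left; exists (t' :: p').
- by right; exists (t :: p).
have [-> /IH[[r -> ?]|[r -> ?]]] :=
  split1_inj (inX_split p uX) (inX_split p' uX') e.
- by left; exists r.
- by right; exists r.
Qed.

Lemma split_surj n u : inX u -> n * i.+1 + i.+2 <= size u ->
  exists p v, [/\ size p = n, inX v & u = split p v].
Proof.
elim: n u => [|n IH] u uX uS; first by exists [::], u.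
have [t [v [vX ue uv]]] := split1_surj uX (leq_trans (leq_addl _ _) uS).
have [|p [w [pS wX ve]]] := IH v vX.
  by have := leq_trans uS uv; rewrite mulSnr addnAC leq_add2r.
by exists (t :: p), w; rewrite /= pS -ve.
Qed.

Lemma inX_a1 : inX [:: a1].
Proof. by []. Qed.

Lemma split_not_surj p : p != [::] ->
  exists2 v, inX v & forall u, inX u -> split p u <> v.
Proof.
case: p => [//|t p] _.
have [t' tN] : exists t' : I, t != t'.
  by case: (eqVneq t ord0) => [->|tN]; [exists ord_max|exists ord0].
exists (split1 t' [:: a1]); first exact: inX_split1.
move=> u uX /(split1_inj (inX_split p uX) inX_a1)[tt' _].
by rewrite tt' eqxx in tN.
Qed.

(** The index words are comparable, say [q = p ++ r]. Cancelling [split p] makes [split r] the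
    identity on X, but for nonempty [r] it misses a word of X. *)
Lemma split_injl p q : (forall v, inX v -> split p v = split q v) -> p = q.
Proof.
suff main p' r :
    (forall v, inX v -> split (p' ++ r) v = split p' v) -> r = [::].
  move=> e; have := e _ inX_a1.
  case/(split_comparable inX_a1 inX_a1) => -[r er _]; rewrite er in e *.
    by rewrite (main p r) ?cats0 // => v vX; rewrite -e.
  by rewrite (main q r) ?cats0.
move=> e; apply/eqP/negPn/negP => /split_not_surj[v vX]; apply=> //.
  exact: vX.
have := e v vX; rewrite split_catl.
elim: p' {e} => //= t p' IH.
by case/split1_inj => //; do ?apply: inX_split.
Qed.

(** * Transporting a right ideal morphism to words over [A] *)

Inductive push_rel (f : pfun i.+2) : seq A -> seq A -> Prop :=
  | PushFix w : push_rel f (a0 :: w) (a0 :: w)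
  | PushSplit p q v of f p = Some q & inX v :
      push_rel f (split p v) (split q v).

Definition push (f : pfun i.+2) : pfun j.+2 := fun u =>
  xget None [set o | exists2 u', o = Some u' & push_rel f u u']%classic.

(** Two decompositions of a word of X differ by a word [r] moved from the index into the argument,
    and [f] commutes with appending [r]. *)
Lemma push_rel_fun f u u1 u2 : right_ideal_morphism f ->
  push_rel f u u1 -> push_rel f u u2 -> u1 = u2.
Proof.
move=> hf; case=> [w|p q v pq vX] h; inversion h as [w' e|p' q' v' pq' vX' e].
- by [].
- by have := inX_split p' vX'; rewrite e.
- by have := inX_split p vX; rewrite -e.
have [[r pe ve]|[r pe ve]] := split_comparable vX' vX e.
  by move: pq; rewrite pe (hf _ _ _ pq') ve => -[<-]; rewrite split_catl.
by move: pq'; rewrite pe (hf _ _ _ pq) ve => -[<-]; rewrite split_catl.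
Qed.

Lemma pushP f u u' : right_ideal_morphism f ->
  push f u = Some u' <-> push_rel f u u'.
Proof.
move=> hf; rewrite /push; split=> [|e].
  by case: xgetP => [o -> [y' -> ?] [<-]|].
apply: xget_unique; first by exists u'.
by move=> _ [y' -> e']; rewrite (push_rel_fun hf e e').
Qed.

(** Reduces injectivity and the image of [push f] to single-valuedness and the domain of
    [push (pinv f)]. *)
Lemma push_rel_inv f u u' : pfun_injective f ->
  push_rel (pinv f) u' u <-> push_rel f u u'.
Proof.
move=> fi; split; case=> [w|p q v /pinvP-/(_ fi) pq vX]; try exact: PushFix.
  exact: PushSplit.
by apply: PushSplit => //; apply/pinvP.
Qed.

Lemma cofin_big (R : set (seq A)) : cofin R -> big R.
Proof.
move=> [N cR]; split; last by exists N.
by move=> x; exists (nseq N a0); apply: cR; rewrite size_cat size_nseq leq_addl.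
Qed.

Lemma push_dom_big f : RIfin f -> big (pdom (push f)).
Proof.
move=> /RIfinP[hf _ [_ [N cf]] _]; apply: cofin_big.
(* A word of X of this length splits off an index word of length [N], which lies in the domain of
   [f]. *)
exists (N * i.+1 + i.+2) => u uS.
have [uX|uX] := boolP (inX u).
  have [p [v [pS vX ->]]] := split_surj uX uS.
  have [|q pq] := cf p; first by rewrite pS.
  by exists (split q v); apply/pushP => //; apply: PushSplit.
case: u uX uS => [_|m w]; first by rewrite addnS.
rewrite /inX negbK /= => /eqP -> _.
by exists (a0 :: w); apply/pushP => //; apply: PushFix.
Qed.

Lemma push_RIfin f : RIfin f -> RIfin (push f).
Proof.
move=> Rf; have Rf' := pinv_RIfin Rf.
have [hf fi _ _] := (RIfinP f).1 Rf; have [hf' _ _ _] := (RIfinP _).1 Rf'.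
apply/RIfinP; split.
- move=> u u' w /(pushP _ _ hf) e; apply/pushP => //.
  case: e => [v|p q v pq vX]; first exact: PushFix.
  by rewrite -!split_catr //; apply: PushSplit => //; apply: inX_cat.
- move=> u1 u2 u' /(pushP _ _ hf) e1 /(pushP _ _ hf) e2.
  by apply: (push_rel_fun hf'); apply/(push_rel_inv _ _ fi); eassumption.
- exact: push_dom_big.
- apply: Defs.big_sub (push_dom_big Rf') => u' [u].
  by move=> /(pushP _ _ hf')/(push_rel_inv _ _ fi) e; exists u; apply/pushP.
Qed.

Lemma push_sub f g : right_ideal_morphism f -> right_ideal_morphism g ->
  pfun_sub f g -> pfun_sub (push f) (push g).
Proof.
move=> hf hg fg u u' /(pushP _ _ hf) e; apply/pushP => //.
by case: e => [w|p q v /fg pq vX]; [apply: PushFix|apply: PushSplit].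
Qed.

(** [PushSplit] allows every word of the domain, not only its prefix code, so the same [v] serves
    for both factors. *)
Lemma push_comp f g : RIfin f -> RIfin g ->
  pfun_sub (push (pfun_comp f g)) (pfun_comp (push f) (push g)).
Proof.
move=> Rf Rg u u'; have [hfg _ _ _] := (RIfinP _).1 (pfun_comp_RIfin Rf Rg).
move/RIfinP: Rf Rg => [hf _ _ _] /RIfinP[hg _ _ _].
move=> /(pushP _ _ hfg) e; apply/pfun_compP.
case: e => [w|p q v /pfun_compP[s ps sq] vX].
  by exists (a0 :: w); apply/pushP => //; apply: PushFix.
by exists (split s v); apply/pushP => //; apply: PushSplit.
Qed.

(** * The group embedding *)

Definition embed (f : HigmanThompson i.+2) : HigmanThompson j.+2 :=
  ht_of (push_RIfin (ht_RIfin f)).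

(** Before the final maximum extension, both sides contain [push (pfun_comp f g)]. *)
Lemma embedM : {morph embed : f g / ht_mul f g >-> ht_mul f g}.
Proof.
move=> f g; apply: ht_ext; rewrite /=.
have [Rf Rg] := (ht_RIfin f, ht_RIfin g).
have Rfg := pfun_comp_RIfin Rf Rg; have Rm := max_extension_RIfin Rfg.
have [hfg _ _ _] := (RIfinP _).1 Rfg; have [hm _ _ _] := (RIfinP _).1 Rm.
transitivity (max_extension (push (pfun_comp f g))).
  apply/esym/max_extension_eq; try exact: push_RIfin.
  by apply: push_sub => //; apply: max_extension_sub.
apply: max_extension_eq; first exact: push_RIfin.
  by apply: pfun_comp_RIfin; apply/max_extension_RIfin/push_RIfin.
move=> u w /(push_comp Rf Rg)/pfun_compP[v gv fv]; apply/pfun_compP.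
by exists v; apply: max_extension_sub => //; apply: push_RIfin.
Qed.

HB.instance Definition _ :=
  isMultiplicative.Build (HigmanThompson i.+2) (HigmanThompson j.+2)
    embed embedM.

(** If [f p = Some q], then [split p] and [split q] agree on X, so [p = q] by [split_injl]. Thus [f]
    is a restriction of the identity, and being maximal it equals it. *)
Lemma embed_ker f : embed f = embed (@ht_one _) -> f = @ht_one _.
Proof.
move=> /(congr1 (@ht_fun _)) /=; rewrite max_extension_pid => e.
have [Rf Ri] := (ht_RIfin f, @pid_RIfin i.+2).
have [[hf _ _ _] [hi _ _ _]] := ((RIfinP f).1 Rf, (RIfinP _).1 Ri).
apply: ht_ext; rewrite ht_oneE -[LHS]ht_max -max_extension_pid.
apply: max_extension_eq => // p q pq; congr Some; apply: split_injl => v vX.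
have : push f (split p v) = Some (split q v).
  by apply/pushP => //; apply: PushSplit.
have : push (@pid _) (split p v) = Some (split p v).
  by apply/pushP => //; apply: PushSplit.
move=> /(max_extension_sub (push_RIfin Ri)) ei.
move=> /(max_extension_sub (push_RIfin Rf)); move: ei.
by rewrite e => -> [].
Qed.

Lemma embed_inj : injective embed.
Proof.
move=> f g fg; have : embed (f * g^-1)%g = embed (@ht_one _).
  by rewrite [LHS]embedM fg -embedM [ht_mul _ _]ht_mulgV.
by move=> /embed_ker e; rewrite -[f](mulgVK g) [(f * _)%g]e [LHS]ht_mul1g.
Qed.

End Splitting.

Theorem theorem1p1 (i j : nat) (hi : 2 <= i) (hj : 2 <= j) :
  exists phi : {multiplicative HigmanThompson i -> HigmanThompson j},
    injective phi.
Proof.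
case: i hi => [|[|i]] // _; case: j hj => [|[|j]] // _.
exists (@embed i j); exact: embed_inj.
Qed.
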